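(* Let $P\subset\mathbb{Z}^n$ be a polymatroid ($n\ge1$). The Cameron–Fink polynomial $\mathscr{Q}'_P(x,y)$ equals $\mathscr{T}_P(x,y)/(x+y-1)$, where $\mathscr{T}_P$ is the polymatroid Tutte polynomial of $P$.
   Context: Notation: $[n]=\{1,\dots,n\}$; $\mathbf e_1,\dots,\mathbf e_n$ is the canonical basis of $\mathbb{R}^n$. A polymatroid in $\mathbb{Z}^n$ is a finite nonempty set $P\subset\mathbb{Z}^n$ satisfying the Exchange Axiom: for any $\mathbf a,\mathbf b\in P$ and any $i\in[n]$ with $a_i>b_i$, there exists $j\in[n]$ such that $a_j<b_j$ and both $\mathbf a-\mathbf e_i+\mathbf e_j$ and $\mathbf b+\mathbf e_i-\mathbf e_j$ belong to $P$. For $\mathbf a\in P$, an index $i\in[n]$ is internally active if there is no $j<i$ with $\mathbf a-\mathbf e_i+\mathbf e_j\in P$, and externally active if there is no $j<i$ with $\mathbf a+\mathbf e_i-\mathbf e_j\in P$. Let $\mathrm{Int}(\mathbf a),\mathrm{Ext}(\mathbf a)\subseteq[n]$ be the sets of internally, respectively externally, active indices. The polymatroid Tutte polynomial is $$\mathscr{T}_P(x,y)=\sum_{\mathbf a\in P}x^{|\mathrm{Int}(\mathbf a)\setminus\mathrm{Ext}(\mathbf a)|}\,y^{|\mathrm{Ext}(\mathbf a)\setminus\mathrm{Int}(\mathbf a)|}\,(x+y-1)^{|\mathrm{Int}(\mathbf a)\cap\mathrm{Ext}(\mathbf a)|}.$$ Cameron–Fink polynomial: let $\mathcal{P}=\mathrm{conv}(P)$,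 $\Delta=\mathrm{conv}(\mathbf e_1,\dots,\mathbf e_n)$, $\nabla=-\Delta$. There is a unique two-variable polynomial $\mathscr{Q}_P$ such that for all positive integers $s,t$, $\mathscr{Q}_P(s,t)=|(\mathcal{P}+s\nabla+t\Delta)\cap\mathbb{Z}^n|$ (Minkowski sum). Write, uniquely with integers $c_{i,j}$, $\mathscr{Q}_P(s,t)=\sum_{i,j\ge0}c_{i,j}\binom si\binom tj$, where $\binom xi=\frac{x(x-1)\cdots(x-i+1)}{i!}$. Then $$\mathscr{Q}'_P(x,y):=\sum_{i,j\ge0}c_{i,j}(x-1)^i(y-1)^j.$$ *)

(* Defs.v *)
From HB Require Import structures.
From mathcomp Require Import all_boot all_order all_algebra finmap.
From mathcomp Require Import boolp classical_sets cardinality reals.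

Set Implicit Arguments.
Unset Strict Implicit.
Unset Printing Implicit Defensive.

Import Order.TTheory GRing.Theory Num.Theory.

Local Open Scope ring_scope.

(* The index set [n] = {1, ..., n} is 'I_n, with its usual order. *)
Definition basis_vec (K : pzRingType) (n : nat) (i : 'I_n) : 'rV[K]_n :=
  delta_mx 0 i.

Section Polymatroid.
Variables (n : nat) (P : {fset 'rV[int]_n}).

Local Notation "''e_' i" := (basis_vec int i) (at level 8, i at level 2).

Definition exchange_axiom : Prop :=
  forall a b, a \in P -> b \in P -> forall i : 'I_n, b 0 i < a 0 i ->
  exists j : 'I_n, [/\ a 0 j < b 0 j,
                       a - 'e_i + 'e_j \in P & b + 'e_i - 'e_j \in P].

Definition polymatroid : Prop := P <> fset0 /\ exchange_axiom.

Definition internally_active (a : 'rV[int]_n) (i : 'I_n) : bool :=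
  ~~ [exists j : 'I_n, (j < i)%N && (a - 'e_i + 'e_j \in P)].

Definition externally_active (a : 'rV[int]_n) (i : 'I_n) : bool :=
  ~~ [exists j : 'I_n, (j < i)%N && (a + 'e_i - 'e_j \in P)].

Definition Int (a : 'rV[int]_n) : {set 'I_n} :=
  [set i | internally_active a i].

Definition Ext (a : 'rV[int]_n) : {set 'I_n} :=
  [set i | externally_active a i].

(* Two-variable polynomials are elements of {poly {poly _}}, with variables
   x = 'X and y = 'Y. *)
Definition tutte : {poly {poly int}} :=
  \sum_(a <- P) 'X ^+ #|Int a :\: Ext a| * 'Y ^+ #|Ext a :\: Int a|
                * ('X + 'Y - 1) ^+ #|Int a :&: Ext a|.

End Polymatroid.

(* Used at A = {poly {poly rat}}, where i`! is a nonzero constant, hence a unit,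
   so that the division is the true one. *)
Definition binomial_poly (A : unitRingType) (x : A) (i : nat) : A :=
  (\prod_(k < i) (x - k%:R)) / (i`!)%:R.

Section CameronFink.
Local Open Scope classical_set_scope.
Variables (R : realType) (n : nat).
Implicit Types A B : set 'rV[R]_n.

Definition convex_hull A : set 'rV[R]_n :=
  [set x | exists (m : nat) (l : 'I_m -> R) (p : 'I_m -> 'rV[R]_n),
     [/\ forall k, 0 <= l k, \sum_k l k = 1, forall k, A (p k)
       & x = \sum_k l k *: p k]].

Definition minkowski_sum A B : set 'rV[R]_n := [set a + b | a in A & b in B].

Definition dilate (t : R) A : set 'rV[R]_n := [set t *: a | a in A].

Definition simplex : set 'rV[R]_n :=
  convex_hull [set basis_vec R i | i in [set: 'I_n]].

Definition nabla : set 'rV[R]_n := [set - d | d in simplex].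

Definition int_point (z : 'rV[int]_n) : 'rV[R]_n := map_mx intr z.

Definition inflated_polytope (P : {fset 'rV[int]_n}) (s t : nat) :
    set 'rV[R]_n :=
  minkowski_sum
    (minkowski_sum (convex_hull [set int_point a | a in [set` P]])
                   (dilate s%:R nabla))
    (dilate t%:R simplex).

Definition lattice_points A : set 'rV[int]_n := [set z | A (int_point z)].

Definition counts_lattice_points (P : {fset 'rV[int]_n})
    (Q : {poly {poly rat}}) : Prop :=
  forall s t : nat, (0 < s)%N -> (0 < t)%N ->
  exists2 k : nat, (lattice_points (inflated_polytope P s t) #= `I_k)%card
                 & Q.[s%:R, t%:R] = k%:R.

Definition is_cameron_fink (P : {fset 'rV[int]_n}) (Q' : {poly {poly int}}) :
    Prop :=
  exists Q : {poly {poly rat}}, counts_lattice_points P Q /\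
  exists (N : nat) (c : nat -> nat -> int),
    Q = \sum_(i < N) \sum_(j < N)
          (c i j)%:~R * binomial_poly 'X i * binomial_poly 'Y j /\
    Q' = \sum_(i < N) \sum_(j < N)
          (c i j)%:~R * ('X - 1) ^+ i * ('Y - 1) ^+ j.

End CameronFink.

(* Main.v *)
Require Import Defs.
From mathcomp Require Import all_boot all_order all_algebra finmap.
From mathcomp Require Import boolp classical_sets cardinality reals.
From HB Require Import structures.
From mathcomp Require Import zify ring lra.

(** Attach to a lattice point [c] the point [a] of the polymatroid [P] for which
    [c - a] is negative only at internally active and positive only at
    externally active indices of [a]; say then that [c - a] is in the cone of [a].

    Such a point exists ([exists_cone_at]): a point of [P] closest to [c], for a
    distance in which larger indices weigh more, has this property, because an
    inactive index allows a move of a unit between it and a smaller index.  It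
    is unique ([cone_at_unique]): at the largest index where two points of [P]
    differ, the Exchange Axiom makes that index inactive in just the way that
    keeps [c] from being on the required side of both.  So the translates of the
    cones by the points of [P] partition the lattice.

    The same point tells whether [c] belongs to the inflated polytope.  Measure
    the distance from a point [x] to [c] by the sum of the positive parts of
    [c - x]; it is at least the sum of [c - x] over any set [S] of indices.  For
    the set [S] of the indices from which a unit can be moved, within [P], to an
    index where [c] exceeds [a], this bound is attained at [a], and the sum of
    [x] over [S] is maximal at [a] ([cone_at_tight]).  So [a] is at least as close
    to [c] as all points of [conv(P)].  Hence [c] is in
    [conv(P) + s nabla + t Delta] exactly when [z = c - a] has coordinate sum
    [t - s] and positive parts adding up to at most [t] ([lattice_point_region],
    [region_lattice_point]), and it remains to count these [z] in each cone.

    The smallest index is active in both ways, so its coordinate is free, and it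
    is determined by the sum.  Any other coordinate is zero, or takes some
    [m >= 1] away from [s] (if internally active) or from [t] (if externally
    active).  Let powers [u^i] and [v^j] stand for [binom(s, i)] and
    [binom(t, j)].  By Pascal's rule, summing over all smaller values of [s] or
    of [t] is then multiplying by [u] or by [v] ([binevXM]).  So the count is
    represented by the product, over the other indices, of factors [1], [1 + u],
    [1 + v] or [1 + u + v], according to the activities ([size_region_seq]).
    Putting [u = x - 1] and [v = y - 1] turns these into [1], [x], [y] and
    [x + y - 1].  The smallest index would contribute one more [x + y - 1], which
    is the divisor in the theorem ([shift_count_poly]). *)

Set Implicit Arguments.
Unset Strict Implicit.
Unset Printing Implicit Defensive.

Import Order.TTheory GRing.Theory Num.Theory.

Local Open Scope ring_scope.

Local Notation e i := (delta_mx (0 : 'I_1) i).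

(** * Evaluation on the binomial basis *)

(** The value at [s] of the polynomial whose coefficients on the basis of the
    binomials [binom(x, i)] are those of [p].  Ending the sum at [s] loses
    nothing, as later terms vanish, and keeps the degree of [p] out of it. *)
Definition binev (A : nzRingType) (s : nat) (p : {poly A}) : A :=
  \sum_(i < s.+1) p`_i *+ 'C(s, i).

Section BinomialEvaluation.
Variable A : nzRingType.
Implicit Types (p : {poly A}) (s : nat).

Lemma binev_is_zmod_morphism s : zmod_morphism (@binev A s).
Proof.
move=> p q; rewrite /binev -sumrB; apply: eq_bigr => i _.
by rewrite coefB mulrnBl.
Qed.

HB.instance Definition _ s :=
  GRing.isZmodMorphism.Build {poly A} A (@binev A s) (binev_is_zmod_morphism s).

Lemma binevCM s c p : binev s (c%:P * p) = c * binev s p.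
Proof.
rewrite /binev mulr_sumr; apply: eq_bigr => i _.
by rewrite coefCM mulrnAr.
Qed.

Lemma binevXn s i : binev s ('X^i : {poly A}) = 'C(s, i)%:R.
Proof.
rewrite /binev.
have [le_is|lt_si] := leqP i s; last first.
  rewrite bin_small // big1 // => j _; rewrite coefXn.
  by rewrite (_ : (j == i :> nat) = false) ?mul0rn //; have := ltn_ord j; lia.
rewrite (bigD1 (Ordinal (le_is : (i < s.+1)%N))) //= coefXn eqxx big1 ?addr0 //.
move=> j; rewrite -val_eqE /= => /negbTE ji.
by rewrite coefXn ji mul0rn.
Qed.

Lemma binevC s c : binev s (c%:P : {poly A}) = c.
Proof. by rewrite -[c%:P]mulr1 binevCM (binevXn s 0) bin0 mulr1. Qed.

(** Pascal's rule. *)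
Lemma binevSXM s p : binev s.+1 ('X * p) = binev s ('X * p) + binev s p.
Proof.
rewrite /binev big_ord_recl coefXM mul0rn add0r.
under eq_bigr => i _ do rewrite lift0 coefXM /= binS mulrnDr.
rewrite big_split /=; congr (_ + _).
rewrite big_ord_recr /= bin_small // mulr0n addr0.
rewrite [RHS]big_ord_recl coefXM mul0rn add0r.
by apply: eq_bigr => i _; rewrite lift0 coefXM.
Qed.

(** Shifting coefficients up is summation over smaller arguments; this is what
    turns the choice of one more coordinate into a multiplication. *)
Lemma binevXM s p : binev s ('X * p) = \sum_(m < s) binev m p.
Proof.
elim: s => [|s IHs]; last by rewrite binevSXM big_ord_recr IHs.
by rewrite /binev big_ord1 big_ord0 coefXM mul0rn.
Qed.

(** Finite differences divide by ['X] up to the constant term, so they reduce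
    the claim for [p * 'X + c] to that for [p], and then to that for [c]. *)
Lemma binev_eq0 p : (forall s, (0 < s)%N -> binev s p = 0) -> p = 0.
Proof.
elim/poly_ind: p => // p c IHp; rewrite commr_polyX => ev0.
have p0 : p = 0.
  apply: IHp => s s_gt0; have := ev0 s s_gt0; rewrite raddfD /= binevC => ev0s.
  by have := ev0 s.+1 isT; rewrite raddfD /= binevSXM binevC addrAC ev0s add0r.
by have := ev0 1%N isT; rewrite p0 mulr0 add0r binevC => ->.
Qed.

End BinomialEvaluation.

(** The integer value at [(s, t)] of the polynomial whose coefficients on the
    basis [binom(s, i) * binom(t, j)] are those of [G] on ['X^i * 'Y^j]. *)
Definition binev2 (s t : nat) (G : {poly {poly int}}) : int :=
  binev t (binev s G).

Lemma binev2_inj (G H : {poly {poly int}}) :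
  (forall s t, (0 < s)%N -> (0 < t)%N -> binev2 s t G = binev2 s t H) -> G = H.
Proof.
move=> eqGH; apply/eqP; rewrite -subr_eq0; apply/eqP.
apply: binev_eq0 => s s_gt0; apply: binev_eq0 => t t_gt0.
by rewrite !raddfB /= [X in X - _](eqGH s t s_gt0 t_gt0) subrr.
Qed.

Definition of_coefs (N : nat) (c : nat -> nat -> int)
    (x y : {poly {poly int}}) : {poly {poly int}} :=
  \sum_(i < N) \sum_(j < N) (c i j)%:~R * x ^+ i * y ^+ j.

Lemma of_coefs_term (a : int) i j :
  a%:~R * 'X ^+ i * 'Y ^+ j = (a%:P * 'X^j)%:P * 'X^i :> {poly {poly int}}.
Proof.
rewrite -[_%:~R in LHS](rmorph_int (@polyC {poly int})).
rewrite -[_%:~R in LHS](rmorph_int (@polyC int)) intz polyCM polyC_exp.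
by rewrite mulrAC.
Qed.

Lemma of_coefs_coef (G : {poly {poly int}}) :
  exists N, G = of_coefs N (fun i j => G`_i`_j) 'X 'Y.
Proof.
exists (maxn (size G) (sizeY G)); set N := maxn _ _.
have expand (B : nzRingType) (p : {poly B}) : (size p <= N)%N ->
    p = \sum_(i < N) (p`_i)%:P * 'X^i.
  move=> le_pN; under eq_bigr => i _ do rewrite mul_polyC.
  rewrite -poly_def; apply/polyP => i; rewrite coef_poly.
  by case: ltnP => // le_Ni; rewrite nth_default // (leq_trans le_pN).
rewrite {1}(expand _ G) ?leq_maxl //; apply: eq_bigr => i _.
under eq_bigr => j _ do rewrite of_coefs_term.
rewrite -mulr_suml -rmorph_sum /=; congr (polyC _ * _).
by apply: expand; rewrite (leq_trans (max_size_coefXY _ _)) ?leq_maxr.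
Qed.

Lemma binev2_of_coefs s t N c :
  binev2 s t (of_coefs N c 'X 'Y)
  = \sum_(i < N) \sum_(j < N) c i j * 'C(s, i)%:R * 'C(t, j)%:R.
Proof.
rewrite /binev2 /of_coefs [binev s _]raddf_sum [LHS]raddf_sum /=.
apply: eq_bigr => i _; rewrite [binev s _]raddf_sum [LHS]raddf_sum /=.
apply: eq_bigr => j _.
rewrite of_coefs_term binevCM binevXn -[LHS]/(binev t _).
by rewrite -(rmorph_nat (@polyC int)) /= mulrAC -polyCM binevCM binevXn.
Qed.

Lemma rmorph_of_coefs (f : {rmorphism {poly {poly int}} -> {poly {poly int}}})
    N c x y : f (of_coefs N c x y) = of_coefs N c (f x) (f y).
Proof.
rewrite rmorph_sum; apply: eq_bigr => i _; rewrite rmorph_sum.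
by apply: eq_bigr => j _; rewrite !rmorphM !rmorphXn rmorph_int.
Qed.

(** * Polynomials representing the lattice point counts *)

(** The substitution of ['X - 1] for ['X] and of ['Y - 1] for ['Y]. *)
Definition shift : {rmorphism {poly {poly int}} -> {poly {poly int}}} :=
  comp_poly ('X - 1) \o map_poly (comp_poly ('X - 1)).

Lemma shiftX : shift 'X = 'X - 1.
Proof. by rewrite /= map_polyX comp_polyX. Qed.

Lemma shiftY : shift 'Y = 'Y - 1.
Proof. by rewrite /= map_polyC comp_polyC /= comp_polyX polyCB. Qed.

Lemma prod_subr_ffact (s i : nat) :
  \prod_(k < i) (s%:R - k%:R) = (s ^_ i)%:R :> rat.
Proof.
elim: i => [|i IHi]; first by rewrite big_ord0.
rewrite big_ord_recr /= IHi ffactnSr natrM.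
have [le_is|lt_si] := leqP i s; first by rewrite natrB.
by rewrite ffact_small // !mul0r.
Qed.

Lemma rmorph_binomial_poly (f : {rmorphism {poly {poly rat}} -> rat}) x s i :
  f x = s%:R -> f (binomial_poly x i) = 'C(s, i)%:R.
Proof.
have fact_neq0 : (i`!)%:R != 0 :> rat by rewrite pnatr_eq0 -lt0n fact_gt0.
have fact_unit : (i`!)%:R \is a @GRing.unit {poly {poly rat}}.
  rewrite -(rmorph_nat (@polyC {poly rat})) rmorph_unit //.
  by rewrite -(rmorph_nat (@polyC rat)) rmorph_unit // unitfE.
move=> fx; rewrite /binomial_poly rmorph_div // rmorph_nat rmorph_prod.
under eq_bigr => k _ do rewrite rmorphB rmorph_nat fx.
by rewrite prod_subr_ffact -bin_ffact natrM mulfK.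
Qed.

Lemma horner2_binomial_expansion (N : nat) (c : nat -> nat -> int) (s t : nat) :
  (\sum_(i < N) \sum_(j < N)
     (c i j)%:~R * binomial_poly 'X i * binomial_poly 'Y j
     : {poly {poly rat}}).[s%:R, t%:R]
  = (binev2 s t (of_coefs N c 'X 'Y))%:~R.
Proof.
pose ev : {rmorphism {poly {poly rat}} -> rat} :=
  horner_eval t%:R \o horner_eval (s%:R%:P).
have evX : ev 'X = s%:R by rewrite /= /horner_eval hornerX hornerC.
have evY : ev 'Y = t%:R by rewrite /= /horner_eval hornerC hornerX.
rewrite -[LHS]/(ev _) binev2_of_coefs !rmorph_sum; apply: eq_bigr => i _.
rewrite !rmorph_sum; apply: eq_bigr => j _; rewrite 2![in LHS]rmorphM.
rewrite (rmorph_binomial_poly i evX) (rmorph_binomial_poly j evY).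
by rewrite rmorph_int 2![in RHS]rmorphM /= !rmorph_nat.
Qed.

(** The counts give the values at positive integers, and these determine the
    coefficients on the binomial basis by [binev2_inj]. *)
Lemma is_cameron_fink_unique (R : realType) n (P : {fset 'rV[int]_n}) Q1 Q2 :
  is_cameron_fink R P Q1 -> is_cameron_fink R P Q2 -> Q1 = Q2.
Proof.
move=> [q1 [cnt1 [N1 [c1 [eq1 ->]]]]] [q2 [cnt2 [N2 [c2 [eq2 ->]]]]].
rewrite -[LHS]/(of_coefs N1 c1 _ _) -[RHS]/(of_coefs N2 c2 _ _).
rewrite -shiftX -shiftY -!rmorph_of_coefs; congr (shift _).
apply: binev2_inj => s t s_gt0 t_gt0.
have [k1 card1 val1] := cnt1 s t s_gt0 t_gt0.
have [k2 card2 val2] := cnt2 s t s_gt0 t_gt0.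
apply: (@intr_inj rat).
rewrite -!horner2_binomial_expansion -eq1 -eq2 val1 val2; congr _%:R.
apply/card_eq_II; rewrite card_eq_sym in card1.
exact: card_eq_trans card1 card2.
Qed.

Lemma is_cameron_fink_shift (R : realType) n (P : {fset 'rV[int]_n})
    (G : {poly {poly int}}) (num : nat -> nat -> nat) :
    (forall s t, (0 < s)%N -> (0 < t)%N ->
       (lattice_points (@inflated_polytope R n P s t) #= `I_(num s t))%card) ->
    (forall s t, binev2 s t G = (num s t)%:Z) ->
  is_cameron_fink R P (shift G).
Proof.
move=> cardE numE; have [N defG] := of_coefs_coef G.
set c := (fun i j => _) in defG.
exists (\sum_(i < N) \sum_(j < N)
          (c i j)%:~R * binomial_poly 'X i * binomial_poly 'Y j); split.
  move=> s t s_gt0 t_gt0; exists (num s t); first exact: cardE.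
  by rewrite horner2_binomial_expansion -defG numE.
by exists N, c; split=> //; rewrite {1}defG rmorph_of_coefs shiftX shiftY.
Qed.

(** * Counting the lattice points around one point of a polymatroid *)

Definition pos_part (x : int) : nat := if x is Posz m then m else 0%N.

Lemma pos_partN x : (pos_part x)%:Z - (pos_part (- x))%:Z = x.
Proof. by case: x => [[|m]|m]; rewrite /= ?subr0 // NegzE sub0r. Qed.

Lemma pos_partB (t s : nat) : pos_part (t%:Z - s%:Z) = (t - s)%N.
Proof. by rewrite /pos_part; case def_x: (t%:Z - s%:Z) => [m|m]; lia. Qed.

Lemma uniq_swap (T : eqType) (x y : T) s :
  uniq [:: x, y & s] = uniq [:: y, x & s].
Proof.
by apply: perm_uniq; apply/permPl; exact: (perm_catCA [:: x] [:: y]).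
Qed.

Lemma Posz_sum (T : Type) (r : seq T) (F : T -> nat) :
  (\sum_(i <- r) F i)%N%:Z = \sum_(i <- r) (F i)%:Z.
Proof. exact: (big_morph Posz PoszD). Qed.

Section Region.
Variables (n : nat) (I E : {set 'I_n}).
Implicit Types (z : 'rV[int]_n) (i : 'I_n) (s t : nat).

Definition cone z : Prop :=
  (forall i, z 0 i < 0 -> i \in I) /\ (forall i, 0 < z 0 i -> i \in E).

(** For [z] in the cone of [a], the last two conditions say that [a + z] lies in
    [conv(P) + s nabla + t Delta]. *)
Definition region s t z : Prop :=
  [/\ cone z, \sum_i z 0 i = t%:Z - s%:Z & (\sum_i pos_part (z 0%R i) <= t)%N].

(** The values at [i] that the cone and the budgets [s] for negative and [t] for
    positive parts permit. *)
Definition steps i s t : seq int :=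
  0 :: [seq Negz m | m <- index_iota 0 (if i \in I then s else 0%N)]
    ++ [seq Posz m.+1 | m <- index_iota 0 (if i \in E then t else 0%N)].

(** The points of a region that vanish off [i0 :: r]; the coordinate at [i0] is
    forced by the coordinate sum once those along [r] are chosen. *)
Fixpoint region_seq (i0 : 'I_n) (r : seq 'I_n) s t : seq 'rV[int]_n :=
  if r is i :: r' then
    [seq x *: e i + z | x <- steps i s t,
       z <- region_seq i0 r' (s - pos_part (- x)) (t - pos_part x)]
  else [:: (t%:Z - s%:Z) *: e i0].

Lemma region_seq_cons i0 i r s t : region_seq i0 (i :: r) s t =
  [seq x *: e i + z | x <- steps i s t,
     z <- region_seq i0 r (s - pos_part (- x)) (t - pos_part x)].
Proof. by []. Qed.

Lemma steps_uniq i s t : uniq (steps i s t).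
Proof.
rewrite /steps /= mem_cat cat_uniq !map_inj_uniq ?iota_uniq;
  try by move=> ? ? [].
rewrite andbT negb_or -!andbA; apply/and4P; split=> //.
- by apply/mapP => -[].
- by apply/mapP => -[].
by apply/hasPn => x /mapP[m _ ->]; apply/mapP => -[].
Qed.

Lemma mem_steps i s t x :
  (x \in steps i s t) = [&& (x < 0) ==> (i \in I), (0 < x) ==> (i \in E),
                           (pos_part (- x) <= s)%N & (pos_part x <= t)%N].
Proof.
rewrite in_cons mem_cat; case: x => [[|m]|m].
- by rewrite eqxx.
- rewrite [X in _ || (X || _)](_ : _ = false); last by apply/mapP => -[].
  rewrite mem_map; last by move=> ? ? [].
  by rewrite mem_index_iota /=; case: ifP => //= _; lia.
rewrite [X in _ || (_ || X)](_ : _ = false); last by apply/mapP => -[].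
rewrite mem_map; last by move=> ? ? [].
by rewrite mem_index_iota /=; case: ifP => //= _; lia.
Qed.

Lemma sum_insert (V : nmodType) (f : int -> V) i x z : f 0 = 0 -> z 0 i = 0 ->
  \sum_k f ((x *: e i + z) 0 k) = f x + \sum_k f (z 0 k).
Proof.
move=> f0 zi0; rewrite (bigD1 i) //= [in RHS](bigD1 i) //= !mxE zi0 f0.
rewrite add0r addr0 !eqxx mulr1.
congr (_ + _); apply: eq_bigr => k /negbTE ki.
by rewrite !mxE ki andbF mulr0 add0r.
Qed.

Lemma sum_insertn (f : int -> nat) i x z : f 0 = 0%N -> z 0 i = 0 ->
  (\sum_k f ((x *: e i + z)%R 0%R k) = f x + \sum_k f (z 0%R k))%N.
Proof. exact: (@sum_insert nat). Qed.

Lemma insertE i x z k : z 0 i = 0 ->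
  (x *: e i + z) 0 k = if k == i then x else z 0 k.
Proof.
move=> zi0; rewrite !mxE eqxx /=; case: eqP => [->|_].
  by rewrite zi0 mulr1 addr0.
by rewrite mulr0 add0r.
Qed.

Lemma sum_pos_part z : \sum_i z 0 i
  = (\sum_i pos_part (z 0%R i))%N%:Z - (\sum_i pos_part (- z 0 i)%R)%N%:Z.
Proof.
by rewrite !Posz_sum -sumrB; apply: eq_bigr => i _; rewrite pos_partN.
Qed.

Lemma region_pos_partN_le s t z :
  region s t z -> (\sum_i pos_part (- z 0 i)%R <= s)%N.
Proof. by move=> [_ sum_z pos_z]; have := sum_pos_part z; lia. Qed.

(** Setting the coordinate at [i] to zero turns a point of the region into one of
    the region with [s] and [t] reduced by the parts of that coordinate. *)
Lemma mem_region_seq i0 r s t z : i0 \in I -> i0 \in E -> uniq (i0 :: r) ->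
  z \in region_seq i0 r s t <->
  region s t z /\ (forall i, i \notin i0 :: r -> z 0 i = 0).
Proof.
move=> i0I i0E; elim: r s t z => [|i r IHr] s t z.
  move=> _; have base0 x : x *: e i0 = x *: e i0 + 0 by rewrite addr0.
  rewrite inE; split=> [/eqP ->|[[_ sum_z _] supp_z]].
    have zE k : ((t%:Z - s%:Z) *: e i0) 0 k
        = if k == i0 then t%:Z - s%:Z else 0.
      by rewrite base0 insertE !mxE.
    split; last by move=> k; rewrite inE zE => /negbTE ->.
    split; [split| |].
    - by move=> k; rewrite zE; case: eqP => [->|].
    - by move=> k; rewrite zE; case: eqP => [->|].
    - by rewrite base0 (@sum_insert _ id) ?mxE // big1 ?addr0 // => k;
        rewrite mxE.
    rewrite base0 sum_insertn ?mxE // big1 => [|k _]; last by rewrite mxE.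
    by rewrite addn0 pos_partB leq_subr.
  apply/eqP/rowP => k; rewrite -sum_z (bigD1 i0) //= big1 ?addr0.
    rewrite base0 insertE ?mxE //; case: eqP => [->//|/eqP ki0].
    by apply: supp_z; rewrite inE.
  by move=> j ji0; apply: supp_z; rewrite inE.
rewrite uniq_swap cons_uniq => /andP[i_i0r uniq_i0r].
split.
  move=> /allpairsPdep[x [y [x_step y_in ->]]].
  have [[[coneI coneE] sum_y pos_y] supp_y] := (IHr _ _ _ uniq_i0r).1 y_in.
  have yi0 : y 0 i = 0 by apply: supp_y.
  move: x_step; rewrite mem_steps => /and4P[/implyP xI /implyP xE le_xs le_xt].
  split; last first.
    move=> k; rewrite insertE // 2!inE !negb_or => /and3P[ki0 /negbTE -> kr].
    by apply: supp_y; rewrite inE negb_or ki0.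
  split; [split| |].
  - move=> k; rewrite insertE //.
    by case: eqP => [->|_]; [exact: xI|exact: coneI].
  - move=> k; rewrite insertE //.
    by case: eqP => [->|_]; [exact: xE|exact: coneE].
  - by rewrite (@sum_insert _ id) // sum_y; have := pos_partN x; lia.
  by rewrite sum_insertn //; lia.
move=> [regz supp_z].
pose y := \row_k (if k == i then 0 else z 0 k).
have yi0 : y 0 i = 0 by rewrite mxE eqxx.
have zE : z = z 0 i *: e i + y.
  by apply/rowP => k; rewrite insertE // mxE; case: eqP => [->|].
have le_zs := region_pos_partN_le regz.
have := regz => -[[coneI coneE] sum_z pos_z].
have sum_y : z 0 i + \sum_k y 0 k = t%:Z - s%:Z.
  by rewrite -sum_z {2}zE (@sum_insert _ id).
move: pos_z; rewrite {1}zE sum_insertn // => pos_z.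
move: le_zs; rewrite {1}zE (@sum_insertn (fun x => pos_part (- x))) // => le_zs.
have zi := pos_partN (z 0 i).
have le_zs' := leq_trans (leq_addr _ _) le_zs.
have le_zt' := leq_trans (leq_addr _ _) pos_z.
apply/allpairsPdep; exists (z 0 i), y; split=> //.
  rewrite mem_steps le_zs' le_zt' !andbT; apply/andP; split; apply/implyP.
    exact: coneI.
  exact: coneE.
apply/IHr => //; split; last first.
  move=> k; rewrite inE negb_or => /andP[ki0 kr]; rewrite mxE.
  by case: eqP => // /eqP ki; apply: supp_z; rewrite 2!inE !negb_or ki0 ki.
split; [split| |].
- by move=> k; rewrite mxE; case: eqP => // _; apply: coneI.
- by move=> k; rewrite mxE; case: eqP => // _; apply: coneE.
- rewrite -!subzn //; move: sum_y zi; set S := \sum_k _; lia.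
by rewrite -(leq_add2l (pos_part (z 0 i))) subnKC.
Qed.

Lemma region_seq_uniq i0 r s t : i0 \in I -> i0 \in E -> uniq (i0 :: r) ->
  uniq (region_seq i0 r s t).
Proof.
move=> i0I i0E; elim: r s t => // i r IHr s t.
rewrite uniq_swap cons_uniq => /andP[i_i0r uniq_i0r].
apply: allpairs_uniq_dep => [|x _|]; [exact: steps_uniq|exact: IHr|].
move=> _ _ /allpairsPdep[x1 [y1 [_ y1_in ->]]]
  /allpairsPdep[x2 [y2 [_ y2_in ->]]].
have [_ /(_ i i_i0r) y1i] := (mem_region_seq _ _ _ i0I i0E uniq_i0r).1 y1_in.
have [_ /(_ i i_i0r) y2i] := (mem_region_seq _ _ _ i0I i0E uniq_i0r).1 y2_in.
move=> /= eq12; have x12 : x1 = x2.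
  by have /rowP/(_ i) := eq12; rewrite !insertE // eqxx.
by rewrite x12 in eq12 *; rewrite (addrI _ (eq12 : _ + y1 = _ + y2)).
Qed.

(** A step at [i] by [-m] or [m] leaves the same problem with [s - m] or [t - m]
    in the remaining coordinates, so the sizes satisfy the recursion of
    [binevXM] in both arguments. *)
Lemma size_region_seq i0 r s t :
  (size (region_seq i0 r s t))%:Z
  = binev2 s t (\prod_(i <- r) (1 + 'X *+ (i \in I) + 'Y *+ (i \in E))).
Proof.
elim: r s t => [|i r IHr] s t.
  by rewrite big_nil /binev2 -[1]polyC1 binevC -polyC1 binevC.
rewrite big_cons region_seq_cons size_allpairs_dep sumnE big_map big_cons.
rewrite big_cat !big_map /= !subn0; set G := \prod_(_ <- _) _ in IHr *.
rewrite !PoszD IHr addrA !mulrDl mul1r /binev2 !raddfD /=.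
congr (_ + _ + _).
  rewrite Posz_sum; case: (i \in I); last by rewrite big_nil mul0r !raddf0.
  rewrite mulr1n binevXM raddf_sum /= big_rev_mkord subn0.
  by apply: eq_bigr => m _; rewrite IHr subnSK ?ltn_ord // subKn // ltnW.
rewrite Posz_sum; case: (i \in E); last by rewrite big_nil mul0r !raddf0.
rewrite mulr1n binevCM binevXM big_rev_mkord subn0.
by apply: eq_bigr => m _; rewrite IHr subnSK ?ltn_ord // subKn // ltnW.
Qed.

End Region.

(** * The point of a polymatroid attached to a lattice point *)

Section Polymatroid.
Variables (n : nat) (P : {fset 'rV[int]_n}).
Implicit Types (a b c x y : 'rV[int]_n) (i j k : 'I_n).

Hypothesis exchP : exchange_axiom P.

Lemma exchange a b i : a \in P -> b \in P -> b 0 i < a 0 i ->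
  exists j, [/\ a 0 j < b 0 j, a - e i + e j \in P & b + e i - e j \in P].
Proof. by move=> aP bP; exact: exchP. Qed.

Local Notation cone_at a c := (cone (Int P a) (Ext P a) (c - a)).

Lemma subdelta_addE a i j k : (a - e i + e j) 0 k
  = a 0 k - (k == i)%:R + (k == j)%:R.
Proof. by rewrite !mxE eqxx. Qed.

Lemma adddelta_subE a i j k : (a + e i - e j) 0 k
  = a 0 k + (k == i)%:R - (k == j)%:R.
Proof. by rewrite !mxE eqxx. Qed.

Lemma not_Int a i : i \notin Int P a ->
  exists2 j : 'I_n, (j < i)%N & a - e i + e j \in P.
Proof. by rewrite inE negbK => /existsP[j /andP[]]; exists j. Qed.

Lemma not_Ext a i : i \notin Ext P a ->
  exists2 j : 'I_n, (j < i)%N & a + e i - e j \in P.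
Proof. by rewrite inE negbK => /existsP[j /andP[]]; exists j. Qed.

Lemma weighted_dist_lt x y i j : (j < i)%N ->
  (forall k, k != i -> k != j -> y 0 k = x 0 k) ->
  (absz (y 0%R i)).+1 = absz (x 0 i) ->
  (absz (y 0%R j) <= (absz (x 0%R j)).+1)%N ->
  (\sum_(k < n) k * absz (y 0%R k) < \sum_(k < n) k * absz (x 0%R k))%N.
Proof.
move=> lt_ji eq_xy yi yj; have ij : j != i by rewrite neq_ltn lt_ji.
rewrite (bigD1 i) //= (bigD1 j) //= [X in (_ < X)%N](bigD1 i) //=.
rewrite [X in (_ < _ + X)%N](bigD1 j) //= -yi.
rewrite (eq_bigr (fun k : 'I_n => k * absz (x 0%R k))%N); last first.
  by move=> k /andP[ki kj]; rewrite eq_xy.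
have : (j * absz (y 0%R j) <= j * (absz (x 0%R j)).+1)%N.
  by rewrite leq_mul2l yj orbT.
by rewrite !mulnS; set u := (\sum_(_ < _ | _) _)%N; lia.
Qed.

Lemma subvE x y k : (x - y) 0 k = x 0 k - y 0 k.
Proof. by rewrite !mxE. Qed.

(** An inactive index on the wrong side of [c] allows a move of a unit between it
    and a smaller index.  The move decreases the distance to [c] by one at the
    larger index and increases it by at most one at the smaller, so a distance
    in which larger indices weigh more gets shorter. *)
Lemma exists_cone_at c a : a \in P -> exists2 b, b \in P & cone_at b c.
Proof.
have [m] := ubnP (\sum_(k < n) k * absz ((c - a)%R 0%R k))%N.
elim: m a => // m IHm a; rewrite ltnS => le_m aP.
have neq_lt i j : (j < i)%N -> ((i == j) = false) * ((j == i) = false).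
  by move=> lt_ji; rewrite (eq_sym i) -val_eqE ltn_eqF.
case: (boolP [forall i, ((c - a) 0 i < 0) ==> (i \in Int P a)]) => [intP|].
  case: (boolP [forall i, (0 < (c - a) 0 i) ==> (i \in Ext P a)]) => [extP|].
    by exists a => //; split=> i; apply/implyP; move: i; apply/forallP.
  rewrite negb_forall => /existsP[i]; rewrite negb_imply => /andP[pos_i].
  move=> /not_Ext[j lt_ji bP]; apply: IHm bP; apply: leq_trans le_m.
  apply: (@weighted_dist_lt _ _ i j) => // [k /negbTE ki /negbTE kj||].
  - by rewrite !(subvE c) adddelta_subE ki kj addr0 subr0.
  - by move: pos_i; rewrite !(subvE c) adddelta_subE eqxx (neq_lt i j) //=; lia.
  by rewrite !(subvE c) adddelta_subE eqxx (neq_lt i j) //=; lia.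
rewrite negb_forall => /existsP[i]; rewrite negb_imply => /andP[neg_i].
move=> /not_Int[j lt_ji bP]; apply: IHm bP; apply: leq_trans le_m.
apply: (@weighted_dist_lt _ _ i j) => // [k /negbTE ki /negbTE kj||].
- by rewrite !(subvE c) subdelta_addE ki kj addr0 subr0.
- by move: neg_i; rewrite !(subvE c) subdelta_addE eqxx (neq_lt i j) //=; lia.
by rewrite !(subvE c) subdelta_addE eqxx (neq_lt i j) //=; lia.
Qed.

(** At the last index [k] where two points differ, exchange with a smaller index
    shows [k] to be internally inactive for the larger and externally inactive
    for the smaller of them; then [c] would be at [k] at least the larger and at
    most the smaller coordinate. *)
Lemma cone_at_unique a b c : a \in P -> b \in P ->
  cone_at a c -> cone_at b c -> a = b.
Proof.
suff main x y k : x \in P -> y \in P -> cone_at x c -> cone_at y c ->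
    (forall j, x 0 j != y 0 j -> (j <= k)%N) -> y 0 k < x 0 k -> False.
  move=> aP bP cone_a cone_b; apply/rowP => k; apply/eqP/negPn/negP => neq_k.
  pose F (j : 'I_n) := nat_of_ord j.
  have [/= i neq_i max_i] := @arg_maxnP _ k (fun j => a 0 j != b 0 j) F neq_k.
  have [lt_i|gt_i|eq_i] := ltgtP (a 0 i) (b 0 i).
  - by apply: (main b a i) => // j; rewrite eq_sym; exact: max_i.
  - exact: (main a b i).
  by rewrite eq_i eqxx in neq_i.
move=> xP yP [intx _] [_ exty] max_k lt_k.
have [j [lt_j xj yj]] := exchange xP yP lt_k.
have lt_jk : (j < k)%N.
  have le_jk : (j <= k)%N by apply: max_k; rewrite lt_eqF.
  rewrite ltn_neqAle le_jk andbT; apply: contraTneq lt_k => /val_inj <-.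
  by rewrite -leNgt ltW.
have : ~~ ((c - x) 0 k < 0).
  apply/negP => /intx; rewrite inE => /negP; apply.
  by apply/existsP; exists j; rewrite lt_jk.
have : ~~ (0 < (c - y) 0 k).
  apply/negP => /exty; rewrite inE => /negP; apply.
  by apply/existsP; exists j; rewrite lt_jk.
by rewrite !subvE -!leNgt; move: lt_k; lia.
Qed.

(** Local optimality implies global optimality: a better [b] could be moved closer
    to [a] by an exchange that stays inside [S], keeping its sum over [S], until
    it is below [a] everywhere on [S]. *)
Lemma tight_le a (S : {set 'I_n}) : a \in P ->
    (forall i j, i \in S -> a + e i - e j \in P -> j \in S) ->
  forall b, b \in P -> \sum_(i in S) b 0 i <= \sum_(i in S) a 0 i.
Proof.
move=> aP closedS b.
have [m] := ubnP (\sum_k absz (b 0%R k - a 0%R k)%R)%N.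
elim: m b => // m IHm b; rewrite ltnS => le_m bP.
case: (boolP [forall i in S, b 0 i <= a 0 i]) => [/forall_inP le_ba|].
  exact: ler_sum.
rewrite negb_forall_in => /exists_inP[i iS]; rewrite -ltNge => lt_i.
have [j [lt_j b'P /closedS-/(_ iS) jS]] := exchange bP aP lt_i.
have ij : i != j by apply: contraTneq lt_i => ->; rewrite -leNgt ltW.
suff -> : \sum_(k in S) b 0 k = \sum_(k in S) (b - e i + e j) 0 k.
  apply: IHm b'P; apply: leq_trans le_m.
  rewrite (bigD1 i) //= [X in (_ < X)%N](bigD1 i) //= -addSn leq_add //.
    by rewrite subdelta_addE eqxx (negbTE ij); move: lt_i; lia.
  apply: leq_sum => k ki; rewrite subdelta_addE (negbTE ki).
  by case: eqP => [->|_]; move: lt_j; lia.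
have sum_delta l : l \in S -> \sum_(k in S) (k == l)%:R = 1 :> int.
  by move=> lS; rewrite (bigD1 l) //= eqxx big1 // => k /andP[_ /negbTE ->].
under [RHS]eq_bigr => k _ do rewrite subdelta_addE.
by rewrite big_split sumrB /= !sum_delta // subrK.
Qed.

(** The certificate that no point of [P] is closer to [c] than [a]: the set of the
    indices from which a unit can be moved to an index where [c] exceeds [a].
    It avoids the indices where [c] is below [a], since such a move would
    contradict the activity of the larger of its two indices. *)
Lemma cone_at_tight a c : a \in P -> cone_at a c ->
  exists S : {set 'I_n},
    [/\ forall i, 0 < (c - a) 0 i -> i \in S,
        forall i, i \in S -> 0 <= (c - a) 0 i
      & forall b, b \in P -> \sum_(i in S) b 0 i <= \sum_(i in S) a 0 i].
Proof.
move=> aP [cone_int cone_ext].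
pose S := [set j | [exists i, (0 < (c - a) 0 i) && (a + e i - e j \in P)]].
exists S; split=> [i pos_i|j|].
- by rewrite inE; apply/existsP; exists i; rewrite pos_i addrK.
- rewrite inE => /existsP[i /andP[pos_i swapP]].
  rewrite leNgt; apply/negP => neg_j.
  have ij : i != j by apply: contraTneq neg_j => <-; rewrite -leNgt ltW.
  have [lt_ij|le_ji] := ltnP i j.
    have := cone_int _ neg_j; rewrite inE => /negP; apply; apply/existsP.
    by exists i; rewrite lt_ij addrAC.
  have := cone_ext _ pos_i; rewrite inE => /negP; apply; apply/existsP.
  by exists j; rewrite swapP andbT ltn_neqAle eq_sym ij.
(* [S] is closed because the relation [a + e i - e j \in P] is transitive. *)
apply: tight_le => // j k; rewrite !inE => /existsP[i /andP[pos_i ijP]] jkP.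
apply/existsP; exists i; rewrite pos_i /=.
have [ik|ik] := eqVneq i k; first by rewrite ik addrK.
have [ij|ij] := eqVneq i j; first by rewrite ij.
have [jk|jk] := eqVneq j k; first by rewrite -jk.
(* [a + e j - e k] exceeds [a + e i - e j] only at [j], so the exchange at [i] can
   only be with [j]. *)
have lt_i : (a + e j - e k) 0 i < (a + e i - e j) 0 i.
  rewrite !adddelta_subE eqxx (negbTE ij) (negbTE ik); lia.
have [l [lt_l _ lP]] := exchange ijP jkP lt_i.
suff lj : l = j.
  by move: lP; rewrite lj addrAC [a + e j - e k]addrAC addrK addrAC.
move: lt_l; rewrite !adddelta_subE; case: (l =P j) => [//|_].
by case: (l == i); case: (l == k); lia.
Qed.

End Polymatroid.

(** * Lattice points of the inflated polytope *)

Section LatticePoints.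
Variables (R : realType) (n : nat) (P : {fset 'rV[int]_n}).
Implicit Types (a b c z : 'rV[int]_n) (x d : 'rV[R]_n) (S : {set 'I_n}).

Lemma simplexP d :
  @simplex R n d <-> (forall i, 0 <= d 0 i) /\ \sum_i d 0 i = 1.
Proof.
have basisE i k : basis_vec R i 0 k = (k == i)%:R by rewrite mxE eqxx.
split=> [[m [l [p [l_ge0 sum_l p_basis ->]]]]|[d_ge0 sum_d]].
  have sum_p k : \sum_i p k 0 i = 1.
    have [i _ <-] := p_basis k.
    rewrite (bigD1 i) //= basisE eqxx big1 ?addr0 //.
    by move=> j /negbTE ji; rewrite basisE ji.
  split=> [i|].
    rewrite summxE sumr_ge0 // => k _; rewrite mxE mulr_ge0 //.
    by have [j _ <-] := p_basis k; rewrite basisE ler0n.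
  under eq_bigr => i _ do rewrite summxE.
  rewrite exchange_big /= -[RHS]sum_l; apply: eq_bigr => k _.
  under eq_bigr => i _ do rewrite mxE.
  by rewrite -mulr_sumr sum_p mulr1.
exists n, (fun i => d 0 i), (basis_vec R (n := n)); split=> //.
exact: row_sum_delta.
Qed.

Lemma sum_setT (V : nmodType) (F : 'I_n -> V) :
  \sum_(i in [set: 'I_n]) F i = \sum_i F i.
Proof. by apply: eq_bigl => i; rewrite inE. Qed.

(** Only coordinate sums are retained from a point of the hull, since these are
    all that the linear inequalities below involve. *)
Lemma convex_hull_sums x :
    convex_hull [set @int_point R n a | a in [set` P]]%classic x ->
  exists (m : nat) (l : 'I_m -> R) (b : 'I_m -> 'rV[int]_n),
    [/\ forall k, 0 <= l k, \sum_k l k = 1, forall k, b k \in P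
      & forall S, \sum_(i in S) x 0 i
                  = \sum_k l k * (\sum_(i in S) b k 0 i)%:~R].
Proof.
move=> [m [l [p [l_ge0 sum_l p_in ->]]]].
have /choice[b bP] k : exists b, b \in P /\ @int_point R n b = p k.
  by have [b bP <-] := p_in k; exists b.
exists m, l, b; split=> // [k|S]; first by have [] := bP k.
under eq_bigr => i _ do rewrite summxE.
rewrite exchange_big /=; apply: eq_bigr => k _.
rewrite rmorph_sum mulr_sumr; apply: eq_bigr => i _.
by have [_ <-] := bP k; rewrite !mxE.
Qed.

(** The sum over the set [S] of [cone_at_tight] is maximal at [a] not only in [P]
    but in its hull.  Comparing [c] with the hull point [x] over [S] thus bounds
    the positive parts of [c - a] by the contribution of the simplex dilated by
    [t].  This is why inflating the hull adds no lattice points to those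
    obtained from [P]. *)
Lemma lattice_point_region c s t : polymatroid P ->
  lattice_points (@inflated_polytope R n P s t) c ->
  exists2 a, a \in P & region (Int P a) (Ext P a) s t (c - a).
Proof.
move=> [/eqP/fset0Pn[a0 a0P] exchP].
move=> [_ [x hull_x [_ [_ [u simplex_u <-] <-] <-]] [_ [v simplex_v <-] def_c]].
have [m [l [b [l_ge0 sum_l bP x_sum]]]] := convex_hull_sums hull_x.
have [/simplexP[u_ge0 sum_u] /simplexP[v_ge0 sum_v]] := (simplex_u, simplex_v).
have [a aP cone_a] := exists_cone_at c a0P.
exists a => //; have [S [posS S_ge0 S_max]] := cone_at_tight exchP aP cone_a.
have cE i : (c 0 i)%:~R = x 0 i - s%:R * u 0 i + t%:R * v 0 i.
  by have /rowP/(_ i) := def_c; rewrite !mxE mulrN => <-.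
(* The full set of indices is tight at every point of [P]. *)
have sum_P y : y \in P -> \sum_i y 0 i = \sum_i a 0 i.
  have sum_le y1 y2 : y1 \in P -> y2 \in P ->
      \sum_(i in [set: 'I_n]) y1 0 i <= \sum_(i in [set: 'I_n]) y2 0 i.
    by move=> y1P y2P; apply: (tight_le exchP) => // i j; rewrite !inE.
  move=> yP; have := sum_le _ _ yP aP; have := sum_le _ _ aP yP.
  by rewrite !sum_setT => le1 le2; apply/eqP; rewrite eq_le le1 le2.
have sum_x : \sum_i x 0 i = (\sum_i a 0 i)%:~R.
  have := x_sum [set: 'I_n]; rewrite !sum_setT => ->.
  under eq_bigr => k _ do rewrite sum_setT sum_P //.
  by rewrite -mulr_suml sum_l mul1r.
have le_xa : \sum_(i in S) x 0 i <= (\sum_(i in S) a 0 i)%:~R.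
  have -> : (\sum_(i in S) a 0 i)%:~R
      = \sum_k l k * (\sum_(i in S) a 0 i)%:~R :> R.
    by rewrite -mulr_suml sum_l mul1r.
  rewrite x_sum; apply: ler_sum => k _.
  by apply: ler_wpM2l => //; rewrite ler_int; exact: S_max.
split=> //.
  apply: (@intr_inj R); rewrite rmorphB /= !rmorph_sum /=.
  under eq_bigr => i _ do rewrite subvE rmorphB /= cE.
  rewrite !big_split /= !sumrN -!mulr_sumr sum_u sum_v sum_x rmorph_sum /=.
  by rewrite !mulr1; lra.
rewrite -lez_nat.
have -> : (\sum_i pos_part ((c - a)%R 0%R i))%N%:Z = \sum_(i in S) (c - a) 0 i.
  rewrite Posz_sum [RHS]big_mkcond; apply: eq_bigr => i _.
  case: ifPn => [iS|iS].
    by have := S_ge0 i iS; case: (_ 0 i).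
  by have := contraNN (posS i) iS; case: (_ 0 i) => [[]|].
rewrite -(ler_int R) rmorph_sum /=.
under eq_bigr => i _ do rewrite subvE rmorphB /= cE.
rewrite sumrB !big_split /= sumrN -!mulr_sumr -rmorph_sum /=.
have u_S : 0 <= \sum_(i in S) u 0 i by apply: sumr_ge0.
have v_S : \sum_(i in S) v 0 i <= 1.
  rewrite -sum_v [leRHS](bigID (mem S)) /= lerDl; exact: sumr_ge0.
have : s%:R * \sum_(i in S) u 0 i >= 0 by rewrite mulr_ge0.
have : t%:R * \sum_(i in S) v 0 i <= t%:R by rewrite -[leRHS]mulr1 ler_wpM2l.
by rewrite -[t%:~R]/(t%:R); lra.
Qed.

Lemma simplex_row (g : 'I_n -> nat) r : (0 < r)%N -> (\sum_i g i = r)%N ->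
  simplex (\row_i ((g i)%:R / r%:R) : 'rV[R]_n).
Proof.
move=> r_gt0 sum_g; apply/simplexP; split=> [i|].
  by rewrite mxE divr_ge0.
under eq_bigr => i _ do rewrite mxE.
by rewrite -mulr_suml -natr_sum sum_g divff // pnatr_eq0 -lt0n.
Qed.

Lemma region_lattice_point a z s t : 'I_n -> (0 < s)%N -> (0 < t)%N ->
    a \in P -> \sum_i z 0 i = t%:Z - s%:Z ->
    (\sum_i pos_part (z 0%R i) <= t)%N ->
  lattice_points (@inflated_polytope R n P s t) (a + z).
Proof.
move=> i0 s_gt0 t_gt0 aP sum_z le_zt.
(* The positive and negative parts of [z] add up to [t - k] and [s - k]; adding
   [k] to both at [i0] makes them points of the dilated simplices. *)
pose k := (t - \sum_i pos_part (z 0%R i))%N.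
pose pad (f : int -> nat) (i : 'I_n) := (f (z 0%R i) + (i == i0) * k)%N.
have sum_pad f : (\sum_i pad f i = \sum_i f (z 0%R i) + k)%N.
  rewrite big_split /=; congr (_ + _)%N.
  rewrite (bigD1 i0) //= eqxx mul1n big1 ?addn0 // => i /negbTE ->.
  by rewrite mul0n.
pose v : 'rV[R]_n := \row_i ((pad pos_part i)%:R / t%:R).
pose u : 'rV[R]_n := \row_i ((pad (fun m : int => pos_part (- m)) i)%:R / s%:R).
have simplex_v : simplex v by apply: simplex_row; rewrite // sum_pad subnKC.
have simplex_u : simplex u.
  apply: simplex_row; rewrite // sum_pad /k.
  have := sum_z; rewrite sum_pos_part; lia.
exists (int_point R a - s%:R *: u); last first.
  exists (t%:R *: v); first by exists v.
  apply/rowP => i; rewrite !mxE !rmorphD /= ![s%:R * _]mulrC ![t%:R * _]mulrC.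
  rewrite !divfK ?pnatr_eq0 -?lt0n // -addrA; congr (_ + _).
  rewrite opprD addrACA addNr addr0 addrC.
  by rewrite -[in RHS](pos_partN (z 0 i)) rmorphB.
exists (int_point R a); last first.
  by exists (s%:R *: - u); [exists (- u) => //; exists u|rewrite scalerN].
exists 1%N, (fun=> 1), (fun=> int_point R a); split=> // [|_|].
- by rewrite big_ord1.
- by exists a.
by rewrite big_ord1 scale1r.
Qed.

End LatticePoints.

(** * Summing over the points of the polymatroid *)

Lemma prod_activities (A : comPzRingType) (n : nat) (I E : {set 'I_n})
    (x y : A) :
  \prod_i (1 + (x - 1) *+ (i \in I) + (y - 1) *+ (i \in E))
  = x ^+ #|I :\: E| * y ^+ #|E :\: I| * (x + y - 1) ^+ #|I :&: E|.
Proof.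
rewrite -!prodr_const !(big_mkcond (fun i => i \in _ :\: _)).
rewrite (big_mkcond (fun i => i \in _ :&: _)) -!big_split /=.
apply: eq_bigr => i _; rewrite !inE.
by case: (i \in I); case: (i \in E) => /=; rewrite ?mulr1n ?mulr0n; ring.
Qed.

Definition other_indices (n : nat) (i0 : 'I_n) : seq 'I_n :=
  [seq i <- enum 'I_n | i != i0].

(** The lattice point count of the inflated polytope, with the binomials
    [binom(s, i)] and [binom(t, j)] replaced by powers of ['X] and ['Y]. *)
Definition count_poly (n : nat) (P : {fset 'rV[int]_n}) (i0 : 'I_n) :
    {poly {poly int}} :=
  \sum_(a <- P) \prod_(i <- other_indices i0)
    (1 + 'X *+ (i \in Int P a) + 'Y *+ (i \in Ext P a)).

Section Counting.
Variables (n : nat) (P : {fset 'rV[int]_n}) (i0 : 'I_n).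
Hypotheses (i0_min : forall i : 'I_n, (i0 <= i)%N) (polyP : polymatroid P).

Let others := other_indices i0.

Lemma others_uniq : uniq (i0 :: others).
Proof. by rewrite /= mem_filter eqxx filter_uniq // enum_uniq. Qed.

Lemma mem_others i : i \in i0 :: others.
Proof. by rewrite inE mem_filter mem_enum andbT orbN. Qed.

Lemma min_Int a : i0 \in Int P a.
Proof.
by rewrite inE; apply/existsP => -[j /andP[]]; rewrite ltnNge i0_min.
Qed.

Lemma min_Ext a : i0 \in Ext P a.
Proof.
by rewrite inE; apply/existsP => -[j /andP[]]; rewrite ltnNge i0_min.
Qed.

Let pieces a s t := region_seq (Int P a) (Ext P a) i0 others s t.

Lemma mem_pieces a s t z :
  z \in pieces a s t <-> region (Int P a) (Ext P a) s t z.
Proof.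
rewrite (mem_region_seq _ _ _ (min_Int a) (min_Ext a) others_uniq).
by split=> [[]//|regz]; split=> // i; rewrite mem_others.
Qed.

Let points s t := [seq a + z | a <- P, z <- pieces a s t].

Lemma points_uniq s t : uniq (points s t).
Proof.
apply: allpairs_uniq_dep => [|a _|]; first exact: fset_uniq.
  exact: region_seq_uniq (min_Int a) (min_Ext a) others_uniq.
move=> _ _ /allpairsPdep[a [z [aP z_in ->]]] /allpairsPdep[b [w [bP w_in ->]]].
move=> /= eq_c; have [cone_z _ _] := (mem_pieces _ _ _ _).1 z_in.
have [cone_w _ _] := (mem_pieces _ _ _ _).1 w_in.
have ab : a = b.
  apply: (cone_at_unique polyP.2 (c := a + z) aP bP).
    by rewrite addrC addKr.
  by rewrite eq_c addrC addKr.
by subst b; rewrite (addrI _ (eq_c : _ + z = _ + w)).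
Qed.

Lemma card_lattice_points (R : realType) s t : (0 < s)%N -> (0 < t)%N ->
  (lattice_points (@inflated_polytope R n P s t)
     #= `I_(size (points s t)))%card.
Proof.
move=> s_gt0 t_gt0.
have -> : lattice_points (@inflated_polytope R n P s t)
    = [set` [fset x in points s t]%fset]%classic.
  apply/seteqP; split=> c /=; rewrite !inE.
    move=> /lattice_point_region[//|a aP reg_c]; apply/allpairsPdep.
    by exists a, (c - a); split; [|exact/mem_pieces|rewrite addrC subrK].
  move=> /allpairsPdep[a [z [aP /mem_pieces[_ sum_z pos_z] ->]]].
  exact: region_lattice_point.
by apply/card_eq_fsetP; rewrite card_fseq undup_id // points_uniq.
Qed.

Lemma size_points s t : (size (points s t))%:Z = binev2 s t (count_poly P i0).
Proof.
rewrite size_allpairs_dep sumnE big_map Posz_sum.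
rewrite /binev2 [binev s _]raddf_sum [RHS]raddf_sum /=.
by apply: eq_bigr => a _; rewrite size_region_seq.
Qed.

(** The factor that the smallest index lacks in [count_poly] is ['X + 'Y - 1]
    after the shift, as this index is active in both ways. *)
Lemma shift_count_poly : shift (count_poly P i0) * ('X + 'Y - 1) = tutte P.
Proof.
rewrite rmorph_sum mulr_suml; apply: eq_bigr => a _.
rewrite -prod_activities rmorph_prod (bigD1 i0) //= min_Int min_Ext !mulr1n.
rewrite mulrC; congr (_ * _); first by ring.
rewrite big_filter big_enum_cond; apply: eq_bigr => i _.
have morph (f : {rmorphism {poly {poly int}} -> {poly {poly int}}})
    (u v : bool) : f (1 + 'X *+ u + 'Y *+ v) = 1 + f 'X *+ u + f 'Y *+ v.
  by rewrite !rmorphD rmorph1 !rmorphMn.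
by have := morph shift (i \in Int P a) (i \in Ext P a); rewrite shiftX shiftY.
Qed.

End Counting.

Theorem theorem13p2 (R : realType) (n : nat) (P : {fset 'rV[int]_n}) :
  (0 < n)%N -> polymatroid P ->
  exists Q' : {poly {poly int}},
    unique (is_cameron_fink R P) Q' /\
    tofrac Q' = tofrac (tutte P) / tofrac ('X + 'Y - 1).
Proof.
move=> n_gt0 polyP.
have i0_min (i : 'I_n) : (Ordinal n_gt0 <= i)%N by [].
have cfG : is_cameron_fink R P (shift (count_poly P (Ordinal n_gt0))).
  apply: is_cameron_fink_shift => [s t|s t]; first exact: card_lattice_points.
  by rewrite size_points.
exists (shift (count_poly P (Ordinal n_gt0))); split.
  by split=> // Q' cfQ'; exact: is_cameron_fink_unique cfG cfQ'.
have D_neq0 : 'X + 'Y - 1 != 0 :> {poly {poly int}}.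
  apply/eqP => /(congr1 (fun p : {poly {poly int}} => p`_1)).
  rewrite coefB coefD coefX coefC coef1 /= addr0 subr0 coef0.
  by apply/eqP; exact: oner_neq0.
by rewrite -(shift_count_poly P i0_min) rmorphM mulfK // tofrac_eq0.
Qed.
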